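(* Let $X$ be a discrete metric space of bounded geometry. For every rank distribution $\mathcal{R}$ on $X$, the ghostly ideal $\tilde I(\mathcal{R})$ satisfies $\mathcal{R}(\tilde I(\mathcal{R}))=\mathcal{R}$.
   Context: Bounded geometry: for every $r>0$, $\sup_{x\in X}\sharp B(x,r)<\infty$. A subset $E\subseteq X\times X$ is an entourage if $\sup_{(x,y)\in E}d(x,y)<\infty$. Roe algebra: Fix a separable infinite-dimensional Hilbert space $\mathcal{H}$. Write $T\in\mathfrak{B}(\ell^2(X)\otimes\mathcal{H})$ as a matrix $[T(x,y)]_{x,y\in X}$ with $T(x,y)\in\mathfrak{B}(\mathcal{H})$. $T$ has finite propagation if $\{(x,y):T(x,y)\ne0\}$ is an entourage, and is locally compact if every $T(x,y)$ is compact. $\mathbb{C}[X]$ is the $*$-algebra of locally compact finite propagation operators and $C^*(X)$ is its norm closure. Ideals in $C^*(X)$ are closed and two-sided. Rank distributions: A rank function is a function $\alpha:X\times X\to\mathbb{Z}_{\ge0}$ whose support $\mathrm{supp}(\alpha)=\{(x,y):\alpha(x,y)\neq 0\}$ is an entourage. For an entourage $E$, $(E\cdot\alpha)(x,y)=\sum_{z}\chi_E(x,z)\alpha(z,y)$ and $(\alpha\cdot E)(x,y)=\sum_z\alpha(x,z)\chi_E(z,y)$; $\alpha^t(x,y)=\alpha(y,x)$; sums and the order $\le$ are pointwise. A rank distribution on $X$ is a collection $\mathcal{R}$ of rank functions such that: (i) if $\alpha,\beta\in\mathcal{R}$ and $E$ is an entourage then $\alpha+\beta,\alpha^t,E\cdot\alpha,\alpha\cdot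 E\in\mathcal{R}$; (ii) every rank function with finite support is in $\mathcal{R}$; (iii) if $\alpha$ is a rank function with $\alpha\le\beta$ for some $\beta\in\mathcal{R}$ then $\alpha\in\mathcal{R}$. Truncations: a compact operator $S$ on $\mathcal{H}$ has a singular value decomposition $S=\sum_i\lambda_i(S)\,u_i\otimes v_i$, with $(u\otimes v)x=\langle x,v\rangle u$, and for $\varepsilon>0$ its $\varepsilon$-truncation is $S_\varepsilon=\sum_{i:\lambda_i(S)\ge\varepsilon}\lambda_i(S)u_i\otimes v_i$. For $T\in C^*(X)$, $T_\varepsilon$ is the operator with entries $T_\varepsilon(x,y)=T(x,y)_\varepsilon$. If all entries of $T$ have finite rank, $\mathrm{RANK}(T)(x,y)=\mathrm{rank}(T(x,y))$. For a non-zero ideal $I$ in $C^*(X)$, $\mathcal{R}(I):=\{\mathrm{RANK}(T_\varepsilon):T\in I,\varepsilon>0\}$. For a rank distribution $\mathcal{R}$, the ghostly ideal is $\tilde I(\mathcal{R})=\{T\in C^*(X):\mathrm{RANK}(T_\varepsilon)\in\mathcal{R}\text{ for all }\varepsilon>0\}$, which is a non-zero ideal in $C^*(X)$. *)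

(* Defs.v *)
From HB Require Import structures.
From mathcomp Require Import all_boot all_order all_algebra sesquilinear.
From mathcomp Require Import finmap complex.
From mathcomp Require Import all_classical all_reals all_analysis ring lra.

Set Implicit Arguments.
Unset Strict Implicit.
Unset Printing Implicit Defensive.

Import Order.TTheory GRing.Theory Num.Theory.
Import numFieldNormedType.Exports.

Local Open Scope classical_set_scope.
Local Open Scope complex_scope.
Local Open Scope ring_scope.

Section coarse.
Context {R : realType} {X : metricType R}.
Implicit Types (E : set (X * X)) (a b : X -> X -> nat).

(* [A #<= `I_N] says that A is finite with at most N elements *)
Definition bounded_geometry :=
  forall r : R, 0 < r -> exists N, forall x : X, (ball x r #<= `I_N)%card.

(* "Entourage" in the coarse sense; unrelated to the uniform-space
   [entourage] of the library. *)
Definition coarse_entourage E :=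
  exists C : R, forall x y, E (x, y) -> mdist x y <= C.

Definition supp a : set (X * X) := [set p | a p.1 p.2 != 0%N].

Definition rank_function a := coarse_entourage (supp a).

(* \sum_(z \in _) is the library's finitely supported sum. In bounded geometry
   and for a coarse entourage E the sums below are over finite supports. *)
Definition entourage_mull E a : X -> X -> nat :=
  fun x y => \sum_(z \in [set: X]) (((x, z) \in E) * a z y)%N.

Definition entourage_mulr a E : X -> X -> nat :=
  fun x y => \sum_(z \in [set: X]) (a x z * ((z, y) \in E))%N.

Record rank_distribution (D : set (X -> X -> nat)) : Prop := RankDistribution {
  rkd_sub : D `<=` rank_function ;
  rkd_add : forall a b, D a -> D b -> D (fun x y => (a x y + b x y)%N) ;
  rkd_tr : forall a, D a -> D (fun x y => a y x) ;
  rkd_mull : forall E a, coarse_entourage E -> D a -> D (entourage_mull E a) ;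
  rkd_mulr : forall E a, coarse_entourage E -> D a -> D (entourage_mulr a E) ;
  rkd_fin : forall a, rank_function a -> finite_set (supp a) -> D a ;
  rkd_le : forall a b, rank_function a -> D b ->
    (forall x y, a x y <= b x y)%N -> D a }.

End coarse.
Arguments bounded_geometry {R} X.

(* [inner] is linear in its first argument and conjugate-linear in the second.
   Norms of a normed module over R[i] are R[i]-valued. *)
HB.mixin Record NormedModule_hasInner (R : realType) H
    & NormedModule R[i] H := {
  inner : {dot H for (@Num.conj R[i])} ;
  innerE : forall x : H, inner x x = `|x| ^+ 2 }.

#[short(type="hilbertType")]
HB.structure Definition Hilbert (R : realType) :=
  {H of CompleteNormedModule R[i] H & NormedModule_hasInner R H}.

Local Notation "''[' x , y ]" := (inner x y) : ring_scope.

Definition separable_space (T : topologicalType) :=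
  exists2 A : set T, countable A & dense A.

(* W is a linear subspace of dimension n: f sends the canonical basis to a basis. *)
Definition has_dim (K : fieldType) (V : lmodType K) (W : set V) (n : nat) :=
  exists f : {linear 'rV[K]_n -> V}, injective f /\ range f = W.

Definition infinite_dimensional (R : realType) (H : hilbertType R) :=
  ~ exists n, has_dim [set: H] n.

Section operators.
Context {R : realType} {H : hilbertType R}.
Implicit Types (S : H -> H) (lam : nat -> R) (u v : nat -> H).

(* The image of the unit ball is relatively compact; meant for linear S. *)
Definition compact_operator S :=
  compact (closure (S @` [set x | `|x| <= 1])).

(* dimension of the range (and 0 if the range is not finite-dimensional) *)
Definition rank S : nat := xget 0%N [set n | has_dim (range S) n].

Definition rank_one (u v : H) : H -> H := fun x => '[x, v] *: u.

(* Indices with lam i = 0 are padding: nothing is asked of u i and v i there, so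
   that finite-rank operators are covered. *)
Record is_svd S lam u v : Prop := IsSvd {
  svd_ge0 : forall i, 0 <= lam i ;
  svd_noninc : nonincreasing_seq lam ;
  svd_cvg0 : lam n @[n --> \oo] --> (0 : R) ;
  svd_orthu : forall i j, lam i != 0 -> lam j != 0 -> '[u i, u j] = (i == j)%:R ;
  svd_orthv : forall i j, lam i != 0 -> lam j != 0 -> '[v i, v j] = (i == j)%:R ;
  svd_sum : forall x,
    (\sum_(i < n) (lam i)%:C *: rank_one (u i) (v i) x) @[n --> \oo] --> S x }.

Definition svd S : (nat -> R) * (nat -> H) * (nat -> H) :=
  xget (fun=> 0, fun=> 0, fun=> 0) [set t | is_svd S t.1.1 t.1.2 t.2].

(* The singular values tend to 0, so that this is a finite sum; it does not
   depend on the decomposition picked by [svd]. *)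
Definition truncation (e : R) S : H -> H := fun x =>
  let: (lam, u, v) := svd S in
  \sum_(i \in [set i | e <= lam i]) (lam i)%:C *: rank_one (u i) (v i) x.

End operators.

Section square_summable.
Context {R : realType} (X : choiceType) (H : normedModType R[i]).
Implicit Types f g : X -> H.

Definition rnorm (h : H) : R := complex.Re `|h|.

Definition sqsum f : \bar R := \esum_(x in [set: X]) ((rnorm (f x)) ^+ 2)%:E.

Definition square_summable : {pred X -> H} := mem [set f | (sqsum f < +oo)%E].

Lemma normE (h : H) : `|h| = (rnorm h)%:C.
Proof. by rewrite RRe_real ?normr_real. Qed.

Lemma rnorm_ge0 (h : H) : 0 <= rnorm h.
Proof. by have := normr_ge0 h; rewrite normE lecR. Qed.

Lemma rnormD (h k : H) : rnorm (h + k) <= rnorm h + rnorm k.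
Proof. by have := ler_normD h k; rewrite !normE -rmorphD lecR. Qed.

Lemma rnormZ (c : R[i]) (h : H) : rnorm (c *: h) = complex.Re `|c| * rnorm h.
Proof. by apply: (@complexI R); rewrite -normE normrZ normE rmorphM. Qed.

Lemma sqsum_ge0 f : (0 <= sqsum f)%E.
Proof. by apply: esum_ge0 => x _; rewrite lee_fin sqr_ge0. Qed.

Lemma fin_sqsum f : f \in square_summable -> sqsum f \is a fin_num.
Proof. by rewrite inE => hf; rewrite ge0_fin_numE ?sqsum_ge0. Qed.

Lemma sqsum_ub f (M : R) :
  (forall s : seq X, uniq s -> \sum_(x <- s) rnorm (f x) ^+ 2 <= M) ->
  (sqsum f <= M%:E)%E.
Proof.
move=> hM; apply: ge_ereal_sup => _ [A [finA _] <-].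
by rewrite fsbig_finite//= sumEFin lee_fin; apply: hM; exact: fset_uniq.
Qed.

Lemma sqsum_ge f (s : seq X) : f \in square_summable -> uniq s ->
  \sum_(x <- s) rnorm (f x) ^+ 2 <= fine (sqsum f).
Proof.
move=> hf us; rewrite -lee_fin fineK ?fin_sqsum//.
apply: esum_ge; exists [set` s]; first by split.
by rewrite -fsbig_seq// sumEFin.
Qed.

Lemma sqsumZ_le (c : R[i]) f : f \in square_summable ->
  (sqsum (c *: f) <= ((complex.Re `|c|) ^+ 2 * fine (sqsum f))%:E)%E.
Proof.
move=> hf; apply: sqsum_ub => s us.
under eq_bigr do rewrite rnormZ exprMn.
by rewrite -mulr_sumr ler_wpM2l ?sqr_ge0// sqsum_ge.
Qed.

Lemma sqsumD_le (a b : R) f g : 0 < a -> 0 < b ->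
  f \in square_summable -> g \in square_summable ->
  (sqsum (f + g)%R <=
    ((1 + b / a) * fine (sqsum f) + (1 + a / b) * fine (sqsum g))%R%:E)%E.
Proof.
move=> a0 b0 hf hg; apply: sqsum_ub => s us.
apply: (@le_trans _ _ (\sum_(x <- s) ((1 + b / a) * rnorm (f x) ^+ 2 +
                        (1 + a / b) * rnorm (g x) ^+ 2))).
  apply: ler_sum => x _.
  apply: (@le_trans _ _ ((rnorm (f x) + rnorm (g x)) ^+ 2)).
    by rewrite lerXn2r ?nnegrE ?rnorm_ge0 ?addr_ge0 ?rnorm_ge0 ?rnormD.
  rewrite -subr_ge0.
  have -> : (1 + b / a) * rnorm (f x) ^+ 2 + (1 + a / b) * rnorm (g x) ^+ 2 -
    (rnorm (f x) + rnorm (g x)) ^+ 2 =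
    (b * rnorm (f x) - a * rnorm (g x)) ^+ 2 / (a * b).
    by field; rewrite !lt0r_neq0.
  by rewrite divr_ge0 ?sqr_ge0// mulr_ge0 ?ltW.
rewrite big_split/= -!mulr_sumr lerD// ler_wpM2l ?sqsum_ge//.
  by rewrite addr_ge0// divr_ge0 ?ltW.
by rewrite addr_ge0// divr_ge0 ?ltW.
Qed.

Lemma square_summable_submod : submod_closed square_summable.
Proof.
split=> [|c f g hf hg].
  rewrite inE/= (le_lt_trans (_ : _ <= 0%:E)%E) ?ltry//.
  apply: sqsum_ub => s _; rewrite big1// => x _.
  by rewrite /rnorm normr0 expr0n.
have hcf : c *: f \in square_summable.
  by rewrite inE/= (le_lt_trans (sqsumZ_le c hf)) ?ltry.
by rewrite inE/= (le_lt_trans (sqsumD_le ltr01 ltr01 hcf hg)) ?ltry.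
Qed.

HB.instance Definition _ :=
  GRing.isSubmodClosed.Build _ _ square_summable square_summable_submod.

(* The tensor product of l^2(X) and H, as the space of square-summable functions
   X -> H. *)
Record ell2 := Ell2 { ell2_fun :> X -> H ; _ : ell2_fun \in square_summable }.

HB.instance Definition _ := [isSub for ell2_fun].
HB.instance Definition _ := [Choice of ell2 by <:].
HB.instance Definition _ := [SubChoice_isSubLmodule of ell2 by <:].

Definition ell2_norm (f : ell2) : R := Num.sqrt (fine (sqsum f)).

Lemma sqsumE (f : ell2) : sqsum f = (ell2_norm f ^+ 2)%:E.
Proof.
rewrite /ell2_norm sqr_sqrtr ?fineK ?fin_sqsum//; first exact: (valP f).
by rewrite fine_ge0 ?sqsum_ge0.
Qed.

Lemma ell2_norm_ge0 (f : ell2) : 0 <= ell2_norm f. Proof. exact: sqrtr_ge0. Qed.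

Lemma rnorm_le_ell2 (f : ell2) x : rnorm (f x) <= ell2_norm f.
Proof.
rewrite -(@ler_pXn2r _ 2) ?nnegrE ?rnorm_ge0 ?ell2_norm_ge0//.
rewrite -lee_fin -sqsumE.
have := sqsum_ge (valP f) (isT : uniq [:: x]).
by rewrite big_seq1 -lee_fin fineK ?fin_sqsum//; exact: (valP f).
Qed.

Lemma ell2_norm0_eq0 (f : ell2) : ell2_norm f = 0 -> f = 0.
Proof.
move=> f0; apply: val_inj; apply/funext => x /=.
apply/eqP; rewrite -normr_eq0 normE -(rmorph0 (real_complex R)).
rewrite (inj_eq (@complexI R)) eq_le rnorm_ge0 andbT -f0.
exact: rnorm_le_ell2.
Qed.

Lemma ell2_normD (f g : ell2) : ell2_norm (f + g) <= ell2_norm f + ell2_norm g.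
Proof.
have [f0|f0] := eqVneq (ell2_norm f) 0.
  by rewrite f0 (ell2_norm0_eq0 f0) !add0r.
have [g0|g0] := eqVneq (ell2_norm g) 0.
  by rewrite g0 (ell2_norm0_eq0 g0) !addr0.
have pf : 0 < ell2_norm f by rewrite lt_def f0 ell2_norm_ge0.
have pg : 0 < ell2_norm g by rewrite lt_def g0 ell2_norm_ge0.
rewrite -(@ler_pXn2r _ 2) ?nnegrE ?addr_ge0 ?ell2_norm_ge0//.
rewrite -lee_fin -sqsumE.
apply: le_trans (sqsumD_le pf pg (valP f) (valP g)) _.
rewrite !sqsumE/= lee_fin.
suff -> : (1 + ell2_norm g / ell2_norm f) * ell2_norm f ^+ 2 +
  (1 + ell2_norm f / ell2_norm g) * ell2_norm g ^+ 2 =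
  (ell2_norm f + ell2_norm g) ^+ 2 by [].
by field; rewrite f0 g0.
Qed.

Lemma ell2_normZ_le (c : R[i]) (f : ell2) :
  ell2_norm (c *: f) <= complex.Re `|c| * ell2_norm f.
Proof.
have c0 : 0 <= complex.Re `|c| by have := normr_ge0 c; rewrite lecE => /andP[].
rewrite -(@ler_pXn2r _ 2) ?nnegrE ?mulr_ge0 ?ell2_norm_ge0//.
rewrite exprMn -lee_fin -sqsumE.
by apply: le_trans (sqsumZ_le c (valP f)) _; rewrite sqsumE.
Qed.

Let cnorm (f : ell2) : R[i] := (ell2_norm f)%:C.

Let cnormD (f g : ell2) : cnorm (f + g) <= cnorm f + cnorm g.
Proof. by rewrite /cnorm -rmorphD lecR ell2_normD. Qed.

Let cnormZ (c : R[i]) (f : ell2) : cnorm (c *: f) = `|c| * cnorm f.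
Proof.
have le d (g : ell2) : cnorm (d *: g) <= `|d| * cnorm g.
  have -> : `|d| = (complex.Re `|d|)%:C by rewrite RRe_real ?normr_real.
  by rewrite /cnorm -rmorphM lecR ell2_normZ_le.
have [->|c0] := eqVneq c 0.
  apply/eqP; rewrite eq_le le/= normr0 mul0r /cnorm.
  by rewrite -(rmorph0 (real_complex R)) lecR ell2_norm_ge0.
apply/eqP; rewrite eq_le le/=.
rewrite -ler_pdivlMl ?normr_gt0// -normfV.
by apply: le_trans (le _ _); rewrite scalerA mulVf// scale1r.
Qed.

Let cnorm_eq0 (f : ell2) : cnorm f = 0 -> f = 0.
Proof. by move=> /complexI; exact: ell2_norm0_eq0. Qed.

HB.instance Definition _ :=
  Lmodule_isNormed.Build R[i] ell2 cnormD cnormZ cnorm_eq0.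

Lemma ell2_normE (f : ell2) : `|f| = (ell2_norm f)%:C. Proof. by []. Qed.

Definition single_fun (y : X) (h : H) : X -> H := fun x => if x == y then h else 0.

Lemma single_subproof y h : single_fun y h \in square_summable.
Proof.
rewrite inE/= (@le_lt_trans _ _ (rnorm h ^+ 2)%:E) ?ltry//.
apply: sqsum_ub => s us; have [ys|ys] := boolP (y \in s).
  rewrite (bigD1_seq y)//= /single_fun eqxx big1 ?addr0// => x /negbTE xy.
  by rewrite xy /rnorm normr0 expr0n.
rewrite big_seq big1 ?sqr_ge0// => x xs.
have /negbTE xy : x != y by apply: contraNneq ys => <-.
by rewrite /single_fun xy /rnorm normr0 expr0n.
Qed.

Definition single y h : ell2 := Ell2 (single_subproof y h).

End square_summable.

Section roe.
Context {R : realType} (X : metricType R) (H : hilbertType R).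

Notation op := {linear ell2 X H -> ell2 X H}.
Implicit Types (S T : op) (A : X -> X -> H -> H) (D : set (X -> X -> nat)).

Definition bounded_operator T := exists M : R, forall f, `|T f| <= M%:C * `|f|.

Definition entry T : X -> X -> H -> H := fun x y h => T (single y h) x.

Definition finite_propagation T :=
  coarse_entourage [set p | entry T p.1 p.2 <> fun=> 0].

Definition locally_compact_operator T :=
  forall x y, compact_operator (entry T x y).

Definition algebraic_roe : set op := [set T | [/\ bounded_operator T,
  finite_propagation T & locally_compact_operator T]].

(* The approximation condition says that S is within e of T in operator norm. *)
Definition roe_algebra : set op := [set T | bounded_operator T /\
  forall e : R, 0 < e -> exists2 S, algebraic_roe S &
    forall f, `|T f - S f| <= e%:C * `|f|].

(* The entries of T_e; an operator is represented by its matrix. *)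
Definition truncated_entries (e : R) T : X -> X -> H -> H :=
  fun x y => truncation e (entry T x y).

Definition RANK A : X -> X -> nat := fun x y => rank (A x y).

Definition ideal_ranks (I : set op) : set (X -> X -> nat) :=
  [set a | exists T (e : R), [/\ I T, 0 < e & a = RANK (truncated_entries e T)]].

Definition ghostly_ideal D : set op := [set T | roe_algebra T /\
  forall e : R, 0 < e -> D (RANK (truncated_entries e T))].

End roe.
Arguments algebraic_roe {R} X H.
Arguments roe_algebra {R} X H.
Arguments ghostly_ideal {R X} H D.

(* Main.v *)
Require Import Defs.
From HB Require Import structures.
From mathcomp Require Import all_boot all_order all_algebra sesquilinear.
From mathcomp Require Import finmap complex.
From mathcomp Require Import all_classical all_reals all_analysis ring lra.

(** Every rank distribution equals the set of ranks of its ghostly ideal.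

One inclusion is the definition of the ghostly ideal. For the other one, fix
[a] in [D] and realise it by an operator [T] whose entry at [(x, y)] is an
orthogonal projection [orthoproj (a x y) e] of rank [a x y]. All nonzero singular
values of a projection are equal to 1, so its truncation at [eps] is the
projection itself if [eps <= 1], and 0 if [eps > 1]; hence the rank function of
the truncation of [T] at [eps] is [a] or 0. Both are in [D], so [T] is in the
ghostly ideal, and [a] is the rank function of its truncation at 1.

It remains to see that such a matrix of projections defines an operator of the
algebraic Roe algebra ([ranks_realised_by_projections]). Its propagation is
finite because the support of [a] is an entourage, and its entries are compact
because their ranks are finite ([compact_orthoproj]). Boundedness uses bounded
geometry: if every row and every column of a matrix of contractions has at most
[N] nonzero entries, the matrix defines an operator of norm at most [N]
([matrix_operator_exists]). Infinite dimension provides projections of all finite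
ranks ([exists_orthonormal]).

The truncation refers to an arbitrary singular value decomposition, about which
only the defining properties are available. That its singular values are 0 or 1
is [svd_orthoproj_eq1]; since they are nonincreasing and tend to 0, they are 1 on
an initial segment of the indices and 0 afterwards, and the truncated sum is then
the whole sum ([truncation_orthoproj]). *)

Set Implicit Arguments.
Unset Strict Implicit.
Unset Printing Implicit Defensive.

Import Order.TTheory GRing.Theory Num.Theory.
Import numFieldNormedType.Exports.

Local Open Scope classical_set_scope.
Local Open Scope complex_scope.
Local Open Scope ring_scope.

Local Notation "''[' x , y ]" := (inner x y) : ring_scope.

(** * Dimension of a subspace *)

Section dimension.
Variables (K : fieldType) (V : lmodType K).
Implicit Types W : set V.

(** If [f] and [g] parametrise the same subspace, then [g^-1 \o f] is an injective
linear map of row vectors, that is, a row-free [m] by [n] matrix. *)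
Lemma has_dim_le W m n : has_dim W m -> has_dim W n -> (m <= n)%N.
Proof.
move=> [f [finj fW]] [g [ginj gW]].
have fg r : {s | g s = f r}.
  apply: cid; have: range f (f r) by exists r.
  by rewrite fW -gW => -[s _ <-]; exists s.
pose h r := projT1 (fg r).
have gh r : g (h r) = f r by rewrite /h; case: (fg r).
have hlin : linear h.
  by move=> c r s; apply: ginj; rewrite linearP !gh linearP.
pose hL := GRing.isLinear.Build _ _ _ _ h hlin.
pose hl : {linear 'rV[K]_m -> 'rV[K]_n} := HB.pack h hL.
have hinj : injective hl.
  by move=> r s hrs; apply: finj; rewrite -!gh; congr (g _).
suff : row_free (lin1_mx hl).
  by rewrite /row_free => /eqP <-; exact: rank_leq_col.
apply/inj_row_free => r; rewrite mul_rV_lin1 => h0; apply: hinj.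
by rewrite linear0.
Qed.

Lemma has_dim_uniq W m n : has_dim W m -> has_dim W n -> m = n.
Proof.
move=> Wm Wn; apply/eqP.
by rewrite eqn_leq (has_dim_le Wm Wn) (has_dim_le Wn Wm).
Qed.

End dimension.

(** * Orthogonal projections of finite rank *)

Section projection.
Context {R : realType} {H : hilbertType R}.
Implicit Types (x y u : H) (e : nat -> H) (n : nat).

Lemma rank_eq (S : H -> H) n : has_dim (range S) n -> rank S = n.
Proof.
by move=> Sn; apply: xget_unique => // m Sm; exact: has_dim_uniq Sm Sn.
Qed.

Definition orthonormal_upto n e :=
  forall i j, (i < n)%N -> (j < n)%N -> '[e i, e j] = (i == j)%:R.

(** For [e] orthonormal up to [n], the orthogonal projection onto the span of the
first [n] terms of [e]. *)
Definition orthoproj n e x : H := \sum_(i < n) rank_one (e i) (e i) x.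

Lemma orthoproj_is_linear n e : linear (orthoproj n e).
Proof.
move=> c x y; rewrite /orthoproj scaler_sumr -big_split/=.
apply: eq_bigr => i _.
by rewrite /rank_one linearPl scalerDl -scalerA.
Qed.
HB.instance Definition _ n e :=
  GRing.isLinear.Build _ _ _ _ (orthoproj n e) (orthoproj_is_linear n e).

Lemma inner_combination n e (c : 'I_n -> R[i]) (k : 'I_n) :
  orthonormal_upto n e -> '[\sum_(i < n) c i *: e i, e k] = c k.
Proof.
move=> en; rewrite linear_sumlz (bigD1 k)//= linearZl_LR/=.
rewrite en// eqxx mulr1 big1 ?addr0// => i ik.
by rewrite linearZl_LR/= en// (negbTE (ik : val i != val k)) mulr0.
Qed.

Lemma orthoproj_combination n e (c : 'I_n -> R[i]) : orthonormal_upto n e ->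
  orthoproj n e (\sum_(i < n) c i *: e i) = \sum_(i < n) c i *: e i.
Proof.
by move=> en; apply: eq_bigr => i _; rewrite /rank_one inner_combination.
Qed.

Lemma orthoproj_idem n e x : orthonormal_upto n e ->
  orthoproj n e (orthoproj n e x) = orthoproj n e x.
Proof. by move=> en; rewrite {2 3}/orthoproj orthoproj_combination. Qed.

Lemma inner_sub_orthoproj n e x y : orthonormal_upto n e ->
  '[x - orthoproj n e x, orthoproj n e y] = 0.
Proof.
move=> en; rewrite {2}/orthoproj linear_sumr/= big1// => i _.
by rewrite linearZr_LR/= linearBl/= inner_combination// subrr mulr0.
Qed.

(** Pythagoras for the orthogonal sum [x = (x - P x) + P x]. *)
Lemma orthoproj_contract n e x : orthonormal_upto n e ->
  `|orthoproj n e x| <= `|x|.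
Proof.
move=> en; rewrite -(@ler_pXn2r _ 2) ?nnegrE// -!innerE.
rewrite -{3 4}(subrK (orthoproj n e x) x).
rewrite hnormDd; last exact: inner_sub_orthoproj.
by rewrite lerDr dnorm_ge0.
Qed.

Lemma norm_unit u : '[u, u] = 1 -> `|u| = 1.
Proof. by move=> u1; apply/eqP; rewrite -sqrp_eq1 ?normr_ge0// -innerE u1. Qed.

(** The instance of the Cauchy-Schwarz inequality needed here: it says that the
projection onto the line of [u] is a contraction. *)
Lemma inner_unit_le x u : '[u, u] = 1 -> `|'[x, u]| <= `|x|.
Proof.
move=> u1; have e1 : orthonormal_upto 1 (fun=> u) by case=> [] [].
have := orthoproj_contract x e1.
by rewrite /orthoproj big_ord1 normrZ (norm_unit u1) mulr1.
Qed.

Lemma has_dim_orthoproj n e : orthonormal_upto n e ->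
  has_dim (range (orthoproj n e)) n.
Proof.
move=> en; pose f (r : 'rV[R[i]]_n) : H := \sum_(i < n) r ord0 i *: e i.
have flin : linear f.
  move=> c r s; rewrite /f scaler_sumr -big_split/=; apply: eq_bigr => i _.
  by rewrite !mxE scalerDl scalerA.
pose fL := GRing.isLinear.Build _ _ _ _ f flin.
pose fl : {linear 'rV[R[i]]_n -> H} := HB.pack f fL.
exists fl; split=> /=.
  move=> r s frs; apply/rowP => k.
  rewrite -(inner_combination (r ord0) k en) -(inner_combination (s ord0) k en).
  by congr ('[_, _]).
apply/seteqP; split=> [_ [r _ <-]|_ [x _ <-]].
  by exists (f r) => //; exact: orthoproj_combination.
exists (\row_i '[x, e i]) => //.
by apply: eq_bigr => i _; rewrite mxE.
Qed.

Lemma innerC x y : '[x, y] = Num.conj '[y, x].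
Proof. by rewrite -[RHS]mul1r; exact: hermC. Qed.

(** Gram-Schmidt: if [e] does not span [H], some [x] differs from its projection,
and normalising the difference extends [e] by one vector. *)
Lemma exists_orthonormal n : infinite_dimensional H ->
  exists e : nat -> H, orthonormal_upto n e.
Proof.
move=> Hinf; elim: n => [|n [e en]]; first by exists (fun=> 0).
have [x] : exists x, x - orthoproj n e x != 0.
  apply: contrapT => /forallNP pid; apply: Hinf; exists n.
  suff <- : range (orthoproj n e) = setT by exact: has_dim_orthoproj.
  apply/seteqP; split=> // x _; exists x => //.
  by have /negP := pid x; rewrite negbK subr_eq0 => /eqP <-.
set y := (x - _) => y0.
pose z := `|y|^-1 *: y.
have zz : '[z, z] = 1.
  by rewrite innerE /z normrZ normfV normr_id mulVf ?expr1n// normr_eq0.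
have ze k : (k < n)%N -> '[z, e k] = 0.
  move=> kn; rewrite /z linearZl_LR/= linearBl/=.
  rewrite (inner_combination (fun i : 'I_n => '[x, e i]) (Ordinal kn) en).
  by rewrite subrr mulr0.
have ez k : (k < n)%N -> '[e k, z] = 0.
  by move=> kn; rewrite innerC ze// rmorph0.
exists (fun i => if (i < n)%N then e i else z) => i j.
rewrite !ltnS => lin ljn.
case: ltnP => [i_lt|ni]; case: ltnP => [j_lt|nj].
- exact: en.
- by rewrite (ez _ i_lt) ltn_eqF//; exact: leq_trans nj.
- by rewrite (ze _ j_lt) gtn_eqF//; exact: leq_trans ni.
- have -> : i = n by apply/eqP; rewrite eqn_leq lin.
  have -> : j = n by apply/eqP; rewrite eqn_leq ljn.
  by rewrite eqxx zz.
Qed.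

End projection.

(** * Singular value decompositions of projections *)

Section svd.
Context {R : realType} {H : hilbertType R}.
Implicit Types (x w : H) (n : nat) (e u v : nat -> H).
Implicit Types (S : H -> H) (lam : nat -> R).

Lemma cvg_inner (f : nat -> H) x w : '[w, w] = 1 -> f n @[n --> \oo] --> x ->
  ('[f n, w] : R[i]^o) @[n --> \oo] --> ('[x, w] : R[i]^o).
Proof.
move=> w1 /cvgrPdist_lt fx; apply/cvgrPdist_lt => eps eps0.
near=> n; rewrite -linearBl; apply: le_lt_trans (inner_unit_le _ w1) _.
by near: n; exact: fx.
Unshelve. all: by end_near. Qed.

(** A singular value sequence that vanishes from some index on gives partial sums
that are eventually constant, hence equal to their limit. *)
Lemma sum_rank_one_tail lam u v m k x : (m <= k)%N ->
  (forall i, (m <= i)%N -> lam i = 0) ->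
  \sum_(i < k) (lam i)%:C *: rank_one (u i) (v i) x =
  \sum_(i < m) (lam i)%:C *: rank_one (u i) (v i) x.
Proof.
move=> mk lam0; rewrite -(subnKC mk) big_split_ord/=.
rewrite [X in _ + X]big1 ?addr0// => i _.
by rewrite lam0 ?leq_addr// scale0r.
Qed.

(** The existence of one decomposition is what makes the one chosen by [svd] a
genuine decomposition. *)
Lemma is_svd_orthoproj n e : orthonormal_upto n e ->
  is_svd (orthoproj n e) (fun i => (i < n)%N%:R) e e.
Proof.
move=> en; have lt i : (i < n)%N%:R != 0 :> R -> (i < n)%N.
  by case: ltnP; rewrite ?eqxx.
split=> //.
- move=> i j ij; rewrite ler_nat; case: (ltnP j n) => // jn.
  by rewrite (leq_ltn_trans ij jn).
- apply: cvg_near_cst; near=> k; rewrite ltnNge (_ : (n <= k)%N)//.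
  by near: k; exact: nbhs_infty_ge.
- by move=> i j /lt i_n /lt j_n; exact: en.
- by move=> i j /lt i_n /lt j_n; exact: en.
- move=> x; apply: cvg_near_cst; near=> k.
  rewrite (@sum_rank_one_tail (fun i => (i < n)%N%:R) e e n).
  + by apply: eq_bigr => i _; rewrite ltn_ord scale1r.
  + by near: k; exact: nbhs_infty_ge.
  + by move=> i ni; rewrite ltnNge ni.
Unshelve. all: by end_near. Qed.

(** Pair the partial sums with [u i]: by orthogonality they are constant as soon as
the index [i] is reached, so the limit is this constant. *)
Lemma svd_inner S lam u v i x : is_svd S lam u v -> lam i != 0 ->
  '[S x, u i] = (lam i)%:C * '[x, v i].
Proof.
move=> svdS lami; have ui : '[u i, u i] = 1 by rewrite (svd_orthu svdS)// eqxx.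
have Sx := cvg_inner ui (svd_sum svdS (x := x)).
apply: (cvg_unique (@norm_hausdorff _ R[i]^o) Sx).
apply: cvg_near_cst; near=> k.
have ik : (i < k)%N by near: k; exact: nbhs_infty_gt.
rewrite linear_sumlz (bigD1 (Ordinal ik))//= big1 => [|j ji].
  by rewrite addr0 /rank_one !linearZl_LR/= ui mulr1.
rewrite /rank_one !linearZl_LR/=.
have [->|lamj] := eqVneq (lam j) 0; first by rewrite mul0r.
by rewrite (svd_orthu svdS)// (negbTE (ji : val j != i)) !mulr0.
Unshelve. all: by end_near. Qed.

Lemma svd_apply S lam u v i : is_svd S lam u v -> lam i != 0 ->
  S (v i) = (lam i)%:C *: u i.
Proof.
move=> svdS lami; have vi : '[v i, v i] = 1 by rewrite (svd_orthv svdS)// eqxx.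
apply: (cvg_unique (@norm_hausdorff _ H) (svd_sum svdS (x := v i))).
apply: cvg_near_cst; near=> k.
have ik : (i < k)%N by near: k; exact: nbhs_infty_gt.
rewrite (bigD1 (Ordinal ik))//= big1 => [|j ji].
  by rewrite addr0 /rank_one vi scale1r.
rewrite /rank_one.
have [->|lamj] := eqVneq (lam j) 0; first by rewrite scale0r.
by rewrite (svd_orthv svdS)// eq_sym (negbTE (ji : val j != i)) scale0r scaler0.
Unshelve. all: by end_near. Qed.

(** Write [P] for the projection. On the one hand [lam i = |P (v i)| <= 1]. On the
other hand [u i], being proportional to [P (v i)], is fixed by [P], so that
[1 = '[P (u i), u i] = lam i * '[u i, v i]], where [|'[u i, v i]| <= 1]. *)
Lemma svd_orthoproj_eq1 n e lam u v i : orthonormal_upto n e ->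
  is_svd (orthoproj n e) lam u v -> lam i != 0 -> lam i = 1.
Proof.
move=> en svdP lami.
have ui : '[u i, u i] = 1 by rewrite (svd_orthu svdP)// eqxx.
have vi : '[v i, v i] = 1 by rewrite (svd_orthv svdP)// eqxx.
have lamC : `|(lam i)%:C| = (lam i)%:C.
  by rewrite ger0_norm// lecR (svd_ge0 svdP).
have lamC0 : (lam i)%:C != 0 by rewrite fmorph_eq0.
have Pv := svd_apply svdP lami.
have Pu : orthoproj n e (u i) = u i.
  rewrite -{2}(scalerK lamC0 (u i)) -Pv -{1}(scalerK lamC0 (u i)) -Pv.
  by rewrite linearZ/= orthoproj_idem.
apply/le_anti/andP; split; rewrite -lecR rmorph1 -lamC.
  have := orthoproj_contract (v i) en.
  by rewrite Pv normrZ !norm_unit// mulr1.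
have := svd_inner (u i) svdP lami; rewrite Pu ui => /(congr1 Num.norm).
rewrite normrM normr1 => ->; rewrite ler_piMr//.
by rewrite -(norm_unit ui); exact: inner_unit_le.
Qed.

Lemma svd_values_initial S lam u v : is_svd S lam u v ->
  (forall i, lam i != 0 -> lam i = 1) -> exists m, forall i, lam i = (i < m)%N%:R.
Proof.
move=> svdS lam01.
have [k lamk] : exists k, lam k == 0.
  have /cvgrPdist_lt/(_ 1 ltr01) [N _ hN] := svd_cvg0 svdS.
  exists N; apply/negPn/negP => /lam01 lamN.
  by have := hN N (leqnn N); rewrite /= lamN sub0r normrN normr1 ltxx.
have [m /eqP lamm mmin] := ex_minnP (ex_intro (fun k => lam k == 0) k lamk).
exists m => i; have [im|mi] := ltnP i m.
  by apply: lam01; apply: contraTneq im => /eqP /mmin; rewrite leqNgt.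
rewrite mulr0n; apply/le_anti; rewrite (svd_ge0 svdS) andbT.
by rewrite -lamm (svd_noninc svdS).
Qed.

Lemma truncation_orthoproj n e (eps : R) : orthonormal_upto n e -> 0 < eps ->
  truncation eps (orthoproj n e) = if eps <= 1 then orthoproj n e else fun=> 0.
Proof.
move=> en eps0; rewrite /truncation.
pose P := orthoproj n e.
have : is_svd P (svd P).1.1 (svd P).1.2 (svd P).2.
  apply: (@xgetI _ (fun=> 0, fun=> 0, fun=> 0)
    [set t | is_svd P t.1.1 t.1.2 t.2] (fun i => (i < n)%N%:R, e, e)).
  exact: is_svd_orthoproj.
rewrite -/P; case: (svd _) => [[lam u] v]/= svdP.
have lam01 i : lam i != 0 -> lam i = 1 by exact: svd_orthoproj_eq1 en svdP.
have [m lamE] := svd_values_initial svdP lam01.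
apply/funext => x; case: leP => [eps1|eps1].
  have -> : [set i | eps <= lam i] = `I_m.
    apply/seteqP; split=> i /=; rewrite lamE; case: ltnP => //.
    by rewrite leNgt eps0.
  rewrite -fsbig_ord.
  apply: (cvg_unique (@norm_hausdorff _ H) _ (svd_sum svdP (x := x))).
  apply: cvg_near_cst; near=> k; apply: sum_rank_one_tail.
    by near: k; exact: nbhs_infty_ge.
  by move=> i; rewrite lamE ltnNge => ->.
have -> : [set i | eps <= lam i] = set0.
  apply/seteqP; split=> i //=; rewrite lamE leNgt => /negP; apply.
  by apply: le_lt_trans eps1; rewrite lern1 leq_b1.
by rewrite fsbig_set0.
Unshelve. all: by end_near. Qed.

End svd.

(** * Compactness of projections of finite rank *)

Section compactness.
Context {R : realType} {H : hilbertType R}.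
Implicit Types (w : H) (e : nat -> H) (n : nat).

Lemma continuous_real_scale w : continuous (fun a : R => a%:C *: w).
Proof.
move=> a; apply/cvgrPdist_lt => eps eps0.
have epsE : eps = (complex.Re eps)%:C by rewrite RRe_real ?gtr0_real.
have d0 : 0 < complex.Re eps / (rnorm w + 1).
  by rewrite divr_gt0 ?ltr_wpDl ?rnorm_ge0// -ltcR -epsE.
have wE : `|w| = (rnorm w)%:C by exact: normE.
near=> b; rewrite -scalerBl -rmorphB normrZ wE epsE normc_def/=.
rewrite expr0n addr0 sqrtr_sqr -rmorphM ltcR.
apply: (@le_lt_trans _ _ (`|a - b| * (rnorm w + 1))).
  by rewrite ler_wpM2l// lerDl.
rewrite -ltr_pdivlMr; last by rewrite ltr_wpDl ?rnorm_ge0.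
by near: b; apply: cvgr_dist_lt => //; exact: cvg_id.
Unshelve. all: by end_near. Qed.

Lemma compact_setD (A B : set H) : compact A -> compact B ->
  compact [set x + y | x in A & y in B].
Proof.
move=> cA cB.
have -> : [set x + y | x in A & y in B] = (fun p => p.1 + p.2) @` (A `*` B).
  apply/seteqP; split=> [_ [x Ax [y By <-]]|_ [[x y] [/= Ax By] <-]].
    by exists (x, y).
  by exists x => //; exists y.
apply: continuous_compact; last exact: compact_setX.
by apply: continuous_subspaceT => p; exact: add_continuous.
Qed.

Lemma compact_real_segment w : compact [set a%:C *: w | a in `[-1, 1]%classic].
Proof.
apply: continuous_compact; last exact: segment_compact.
by apply: continuous_subspaceT; exact: continuous_real_scale.
Qed.

(** The combinations with coefficients in the unit disc lie in a sum of [2 n]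
segments, one for the real and one for the imaginary part of each coefficient. *)
Lemma bounded_combination_compact n e : exists2 K : set H, compact K &
  forall c : nat -> R[i], (forall i, `|c i| <= 1) -> K (\sum_(i < n) c i *: e i).
Proof.
elim: n => [|n [K cK sumK]].
  exists [set 0]; first exact: compact_set1.
  by move=> c _; rewrite big_ord0.
exists [set x + y | x in K & y in
  [set x + y | x in [set a%:C *: e n | a in `[-1, 1]%classic] &
               y in [set a%:C *: ('i *: e n) | a in `[-1, 1]%classic]]].
  apply: (compact_setD cK); apply: compact_setD; exact: compact_real_segment.
move=> c c1; rewrite big_ord_recr/=.
exists (\sum_(i < n) c i *: e i); first exact: sumK.
have Rec : complex.Re (c n) \in `[-1, 1]%R.
  by rewrite in_itv/= -ler_norml -lecR; apply: le_trans (normc_ge_Re _) (c1 n).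
have Imc : complex.Im (c n) \in `[-1, 1]%R.
  rewrite in_itv/= -ler_norml -lecR; apply: le_trans (c1 n).
  rewrite normc_def lecR -sqrtr_sqr.
  by case: (c n) => a b /=; rewrite ler_wsqrtr// lerDr sqr_ge0.
exists (c n *: e n) => //.
exists ((complex.Re (c n))%:C *: e n); first by exists (complex.Re (c n)).
exists ((complex.Im (c n))%:C *: ('i *: e n)).
  by exists (complex.Im (c n)).
by rewrite scalerA -scalerDl [in RHS](complexE (c n)) mulrC.
Qed.

(** The coefficients of the projection of a unit vector are in the unit disc, so
the image of the unit ball is contained in a compact set. *)
Lemma compact_orthoproj n e : orthonormal_upto n e ->
  compact_operator (orthoproj n e).
Proof.
move=> en; have [K cK sumK] := bounded_combination_compact n e.
have PK : orthoproj n e @` [set x | `|x| <= 1] `<=` K.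
  move=> _ [x x1 <-].
  (* The coefficients outside [i < n] are set to 0 to keep them bounded by 1. *)
  have := sumK (fun i => if (i < n)%N then '[x, e i] else 0) _.
  under eq_bigr do rewrite ltn_ord; apply => i.
  case: ltnP => [i_n|_]; last by rewrite normr0 ler01.
  by apply: le_trans x1; apply: inner_unit_le; rewrite en// eqxx.
have Kcl : closed K by apply: compact_closed => //; exact: norm_hausdorff.
apply: subclosed_compact cK _; first exact: closed_closure.
by rewrite ((closure_id K).1 Kcl); exact: closureS.
Qed.

End compactness.

(** * Operators given by matrices with bounded rows and columns *)

(** The Cauchy-Schwarz inequality against the constant family 1, by induction: the
cross term [2 * b z * S] is controlled by [0 <= (n * b z - S) ^+ 2]. *)
Lemma sqr_sum_le (R : realFieldType) (T : Type) (r : seq T) (b : T -> R) :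
  (\sum_(y <- r) b y) ^+ 2 <= (size r)%:R * \sum_(y <- r) b y ^+ 2.
Proof.
elim: r => [|z r IH]; first by rewrite !big_nil expr0n mul0r.
rewrite !big_cons/= -natr1; set S := \sum_(y <- r) b y in IH *.
set Q := \sum_(y <- r) b y ^+ 2 in IH *.
have Q0 : 0 <= Q by apply: sumr_ge0 => y _; exact: sqr_ge0.
have : (0 : R) <= (size r)%:R by exact: ler0n.
rewrite le_eqVlt => /predU1P[n0|n0].
  have S0 : S = 0.
    apply/eqP; rewrite -sqrf_eq0 eq_le sqr_ge0 andbT (le_trans IH)//.
    by rewrite -n0 mul0r.
  by rewrite -n0 S0; nra.
set n := (size r)%:R in IH n0 *.
have : 2 * b z * S <= n * b z ^+ 2 + Q.
  rewrite -(ler_pM2l n0).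
  have := sqr_ge0 (n * b z - S); nra.
nra.
Qed.

Section matrix_operator.
Context {R : realType} (X : choiceType) (H : normedModType R[i]).
Variables (A : X -> X -> {linear H -> H}) (row col : X -> {fset X}) (N : nat).
Hypotheses (A_contract : forall x y h, `|A x y h| <= `|h|)
  (row_col : forall x y, y \in row x -> x \in col y)
  (row_le : forall x, (#|` row x| <= N)%N)
  (col_le : forall y, (#|` col y| <= N)%N).

Let matrix_apply (f : X -> H) x := \sum_(y <- row x) A x y (f y).

(** Double counting: each [y] is in the rows of at most [N] of the points of [t].
The sequence [u] lists the points that occur in these rows. *)
Lemma sum_rows_le (b : X -> R) (t : seq X) :
  (forall y, 0 <= b y) -> uniq t ->
  exists2 u : seq X, uniq u &
    \sum_(x <- t) \sum_(y <- row x) b y <= N%:R * \sum_(y <- u) b y.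
Proof.
move=> b0 ut; pose u := undup (flatten [seq enum_fset (row x) | x <- t]).
exists u; first exact: undup_uniq.
have rowE x : x \in t ->
    \sum_(y <- row x) b y = \sum_(y <- u) (if y \in row x then b y else 0).
  move=> xt; rewrite -big_mkcond -[RHS]big_filter; apply: perm_big.
  apply: uniq_perm; rewrite ?filter_uniq ?undup_uniq ?fset_uniq// => y.
  rewrite mem_filter mem_undup; case: (boolP (y \in row x)) => //= yx.
  by apply/esym/flatten_mapP; exists x.
rewrite big_seq (eq_bigr _ (fun x xt => rowE x xt)) -big_seq.
rewrite exchange_big/= mulr_sumr.
apply: ler_sum => y _; rewrite -big_mkcond/= big_const_seq iter_addr_0.
rewrite -[_ *+ _]mulr_natl.
rewrite ler_wpM2r// ler_nat (leq_trans _ (col_le y))// -size_filter.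
apply: uniq_leq_size => [|x]; first exact: filter_uniq.
by rewrite mem_filter => /andP[/row_col].
Qed.

(** One factor [N] comes from the number of terms in a row, when the square of a
sum is bounded by a sum of squares; the other one comes from the number of rows
in which a given [f y] occurs. *)
Lemma sqsum_matrix_le f : f \in square_summable (X := X) (H := H) ->
  (sqsum (matrix_apply f) <= (N%:R ^+ 2 * fine (sqsum f))%:E)%E.
Proof.
move=> fl2; apply: sqsum_ub => t ut.
have [u uu hu] := sum_rows_le (fun y => sqr_ge0 (rnorm (f y))) ut.
apply: (@le_trans _ _
  (N%:R * \sum_(x <- t) \sum_(y <- row x) rnorm (f y) ^+ 2)).
  rewrite mulr_sumr; apply: ler_sum => x _.
  apply: (@le_trans _ _ ((\sum_(y <- row x) rnorm (f y)) ^+ 2)); last first.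
    apply: le_trans (sqr_sum_le _ _) _.
    by rewrite ler_wpM2r ?ler_nat ?sumr_ge0// => y _; exact: sqr_ge0.
  rewrite lerXn2r ?nnegrE ?rnorm_ge0 ?sumr_ge0//.
    by move=> *; exact: rnorm_ge0.
  rewrite /matrix_apply; elim/big_ind2: _ => [|h1 r1 h2 r2 le1 le2|y _].
  - by rewrite /rnorm normr0.
  - by apply: le_trans (rnormD _ _) _; exact: lerD.
  - by rewrite -lecR -!normE.
rewrite expr2 -mulrA ler_wpM2l// (le_trans hu)// ler_wpM2l//.
exact: sqsum_ge.
Qed.

Lemma matrix_operator_exists : exists T : {linear ell2 X H -> ell2 X H},
  (forall f x, T f x = \sum_(y <- row x) A x y (f y)) /\
  (forall f, `|T f| <= (N%:R : R)%:C * `|f|).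
Proof.
have gl2 (f : ell2 X H) : matrix_apply f \in square_summable (X := X) (H := H).
  by rewrite inE/= (le_lt_trans (sqsum_matrix_le (valP f)))// ltry.
pose T f : ell2 X H := Ell2 (gl2 f).
have Tlin : linear T.
  move=> c f h; apply: val_inj; apply/funext => x /=.
  rewrite /matrix_apply/= -[RHS]/(c *: _ + _) scaler_sumr -big_split/=.
  apply: eq_bigr => y _.
  by rewrite -linearP.
pose TL := GRing.isLinear.Build _ _ _ _ T Tlin.
pose Tl : {linear ell2 X H -> ell2 X H} := HB.pack T TL.
exists Tl; split=> // f.
rewrite !ell2_normE -rmorphM lecR.
rewrite -(@ler_pXn2r _ 2) ?nnegrE ?mulr_ge0 ?ell2_norm_ge0//.
rewrite exprMn -lee_fin -sqsumE.
by apply: le_trans (sqsum_matrix_le (valP f)) _; rewrite sqsumE.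
Qed.

End matrix_operator.

(** * Realisation of a rank function *)

Section bounded_geometry_sets.
Context {R : realType} {X : metricType R}.

(** The rows and the columns of the support of [a] are contained in balls of a
fixed radius. *)
Lemma rank_function_bounded_sections (a : X -> X -> nat) : bounded_geometry X ->
  rank_function a -> exists N, forall x,
    ([set y | a x y != 0%N] #<= `I_N)%card /\
    ([set y | a y x != 0%N] #<= `I_N)%card.
Proof.
move=> Xbg [C aC].
have r0 : 0 < `|C| + 1 by rewrite ltr_wpDl.
have [N ballN] := Xbg _ r0; exists N => x.
have lt : forall y, mdist x y <= C -> ball x (`|C| + 1) y.
  move=> y xyC; rewrite ballEmdist/=; apply: le_lt_trans xyC _.
  by apply: le_lt_trans (ler_norm C) _; rewrite ltrDl.
split; apply: card_le_trans (ballN x); apply: subset_card_le => y /= axy;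
  apply: lt.
  exact: (aC x y).
by rewrite metric_sym; exact: (aC y x).
Qed.

End bounded_geometry_sets.

Section realisation.
Context {R : realType} {X : metricType R} {H : hilbertType R}.

(** The entry at [(x, y)] depends on [a x y] only: it is the projection onto the
span of an orthonormal family of [a x y] vectors chosen once for all. *)
Lemma ranks_realised_by_projections (a : X -> X -> nat) :
  bounded_geometry X -> infinite_dimensional H -> rank_function a ->
  exists2 T : {linear ell2 X H -> ell2 X H}, algebraic_roe X H T &
    forall x y, exists2 e : nat -> H, orthonormal_upto (a x y) e &
      entry T x y = orthoproj (a x y) e.
Proof.
move=> Xbg Hinf arank.
have [e eon] := choice (fun n => exists_orthonormal n Hinf).
pose P n : {linear H -> H} := orthoproj n (e n).
have [N secN] := rank_function_bounded_sections Xbg arank.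
pose row x := fset_set [set y | a x y != 0%N].
pose col y := fset_set [set x | a x y != 0%N].
have fin (A : set X) : (A #<= `I_N)%card -> finite_set A.
  by move=> AN; apply/finite_set_leP; exists N.
have rowE x y : (y \in row x) = (a x y != 0%N).
  rewrite in_fset_set; last by apply: fin; exact: (secN x).1.
  by apply/idP/idP; rewrite inE.
have colE x y : (x \in col y) = (a x y != 0%N).
  rewrite in_fset_set; last by apply: fin; exact: (secN y).2.
  by apply/idP/idP; rewrite inE.
have [T [TE Tbounded]] : exists T : {linear ell2 X H -> ell2 X H},
    (forall f x, T f x = \sum_(y <- row x) P (a x y) (f y)) /\
    (forall f, `|T f| <= (N%:R : R)%:C * `|f|).
  apply: (@matrix_operator_exists R X H (fun x y => P (a x y)) row col N).
  - by move=> x y h; exact: orthoproj_contract.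
  - by move=> x y; rewrite rowE colE.
  - by move=> x; apply: geq_card_fset_set; exact: (secN x).1.
  - by move=> y; apply: geq_card_fset_set; exact: (secN y).2.
have Tentry x y : entry T x y = orthoproj (a x y) (e (a x y)).
  apply/funext => h; rewrite /entry TE.
  have other z : z != y -> P (a x z) (single y h z) = 0.
    by move=> zy; rewrite /= /single_fun (negbTE zy) linear0.
  have [yx|yx] := boolP (y \in row x).
    rewrite (bigD1_seq y) ?fset_uniq//=.
    rewrite big1 ?addr0 => [|z zy]; last exact: other.
    by rewrite /single_fun eqxx.
  rewrite big1_seq => [|z /= zx].
    by move: yx; rewrite rowE negbK => /eqP ->; rewrite /orthoproj big_ord0.
  by apply: other; apply: contraNneq yx => <-.
exists T; last by move=> x y; exists (e (a x y)).
split.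
- by exists N%:R.
- have [C aC] := arank; exists C => x y /= Txy; apply: aC => /=.
  apply: contra_not_neq Txy => axy; rewrite Tentry axy.
  by apply/funext => h; rewrite /orthoproj big_ord0.
- by move=> x y; rewrite Tentry; exact: compact_orthoproj.
Qed.

Lemma rank_truncation_orthoproj n (e : nat -> H) (eps : R) :
  orthonormal_upto n e -> 0 < eps ->
  rank (truncation eps (orthoproj n e)) = if eps <= 1 then n else 0%N.
Proof.
move=> en eps0; rewrite truncation_orthoproj//.
case: ifP => _; first by apply: rank_eq; exact: has_dim_orthoproj.
have -> : (fun=> 0) = orthoproj 0 e :> (H -> H).
  by apply/funext => h; rewrite /orthoproj big_ord0.
by apply: rank_eq; apply: has_dim_orthoproj.
Qed.

End realisation.

(** * The theorem *)

Theorem lemma4p3 (R : realType) (X : metricType R) (H : hilbertType R)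
  (Xdiscrete : forall x : X, open [set x])
  (Xbg : bounded_geometry X)
  (Hsep : separable_space H)
  (Hinf : infinite_dimensional H)
  (D : set (X -> X -> nat)) (Drk : rank_distribution D) :
  ideal_ranks (ghostly_ideal H D) = D.
Proof.
apply/seteqP; split=> [_ [T [eps [[_ TD] eps0 ->]]]|a Da]; first exact: TD.
have [T Troe TE] := ranks_realised_by_projections Xbg Hinf (rkd_sub Drk Da).
have RANKT eps : 0 < eps ->
    RANK (truncated_entries eps T) = if eps <= 1 then a else fun _ _ => 0%N.
  move=> eps0; apply/funext => x; apply/funext => y.
  have [e en Txy] := TE x y.
  rewrite /RANK /truncated_entries Txy rank_truncation_orthoproj//.
  by case: ifP.
exists T, 1; split; [split|by []|by rewrite RANKT// lexx].
  split=> [|eps eps0]; first by have [] := Troe.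
  by exists T => // f; rewrite subrr normr0 mulr_ge0// lecR ltW.
move=> eps eps0; rewrite RANKT//; case: ifP => // _.
by apply: (rkd_le Drk _ Da) => //; exists 0 => x y.
Qed.
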